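(* For $n\ge 3$, let $G_n=C_n\square P_2$ be the prism graph. Then \[ \zeta(G_n)= \begin{cases} 9, & n=3,\\ 4, & n\equiv 0\pmod{4},\\ 2n, & n\equiv 1,3\pmod{4},\\ 51, & n=6,\\ n(n+2), & n\equiv 2\pmod{4},\ n\ge 10. \end{cases} \]
   Context: For $n\ge3$, the prism graph $G_n=C_n\square P_2$ has vertex set $\{(t,i),(b,i): i\in\mathbb{Z}_n\}$ (indices mod $n$), with edges joining $(t,i)$ to $(t,i\pm1)$ and to $(b,i)$, and $(b,i)$ to $(b,i\pm1)$ and to $(t,i)$. A set $S$ of vertices is dominating if every vertex is in $S$ or adjacent to a vertex of $S$. $\gamma(G)$ is the minimum size of a dominating set, and the dominion $\zeta(G)$ is the number of dominating sets of size $\gamma(G)$, where the graph is labeled, so distinct vertex subsets are counted separately (even if related by rotation). *)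

(* Defs.v *)
From mathcomp Require Import all_boot.

Set Implicit Arguments.
Unset Strict Implicit.
Unset Printing Implicit Defensive.

(* A graph is given by its adjacency relation on a finite vertex type. *)
Definition dominating (T : finType) (e : rel T) (S : {set T}) : bool :=
  [forall v, (v \in S) || [exists u in S, e v u]].

(* The full vertex set is always dominating, so the minimum is attained. *)
Definition domination_number (T : finType) (e : rel T) : nat :=
  #|[arg min_(S < [set: T] | dominating e S) #|S|]|.

Definition dominion (T : finType) (e : rel T) : nat :=
  #|[set S : {set T} | dominating e S & #|S| == domination_number e]|.

(* C_n [] P_2: the vertex (true, i) is (t, i) and (false, i) is (b, i);
   ordS and ord_pred are i + 1 and i - 1 modulo n. *)
Definition prism (n : nat) : rel (bool * 'I_n) :=
  fun u v =>
    ((u.1 == v.1) && ((v.2 == ordS u.2) || (v.2 == ord_pred u.2)))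
    || ((u.1 != v.1) && (u.2 == v.2)).

(* Main.v *)
(** A vertex of the prism dominates exactly four of its [2 n] vertices, so a
    dominating set [S] has total overdomination [4 #|S| - 2 n].  This is a sum
    of nonnegative local terms, each depending on three consecutive columns,
    so dominating sets correspond to closed walks of length [n] in a graph on
    pairs of columns, weighted by overdomination.  Minimum dominating sets are
    the closed walks of weight 0, 2 or 4 according to [n] modulo 4.  On the
    walks of weight at most 4 the transfer operator [T] satisfies
    [T^9 (T^4 - 1)^3 = 0], so the number of closed walks obeys a linear
    recurrence in [n], and the formulas follow from finitely many values. *)

Require Import Defs.
From mathcomp Require Import all_boot.
From mathcomp Require Import zify.

Set Implicit Arguments.
Unset Strict Implicit.
Unset Printing Implicit Defensive.

(** * Transfer operator on pairs of columns *)

Definition column := (bool * bool)%type.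
Definition state := (column * column)%type.

(** How often the top vertex of the middle column [y] is dominated: [y.2] is its neighbour along the
    rung. On covered triples the predecessors in [excess] are exact. *)
Definition domt (x y z : column) : nat := x.1 + y.1 + z.1 + y.2.
Definition domb (x y z : column) : nat := x.2 + y.2 + z.2 + y.1.
Definition covered x y z := (0 < domt x y z) && (0 < domb x y z).
Definition excess x y z := (domt x y z).-1 + (domb x y z).-1.

(** The state [(x, y)] holds the last two columns read; [e] is the overdomination still to be spent,
    and it must be used up exactly. *)
Fixpoint walk (x y : column) (u : seq column) (e : nat) : bool :=
  if u is z :: u' then
    [&& covered x y z, excess x y z <= e & walk y z u' (e - excess x y z)]
  else e == 0.

Fixpoint endpoint (x y : column) (u : seq column) : state :=
  if u is z :: u' then endpoint y z u' else (x, y).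

Definition walks n (q p : state) e : nat :=
  \sum_(u : n.-tuple column) (walk p.1 p.2 u e && (endpoint p.1 p.2 u == q)).

Definition columns : seq column :=
  [:: (false, false); (false, true); (true, false); (true, true)].

Definition states : seq state := [seq (x, y) | x <- columns, y <- columns].

Definition transfer (v : state -> nat -> nat) (p : state) (e : nat) : nat :=
  sumn [seq (if covered p.1 p.2 z && (excess p.1 p.2 z <= e)
             then v (p.2, z) (e - excess p.1 p.2 z) else 0) | z <- columns].

Definition delta (q p : state) (e : nat) : nat := (p == q) && (e == 0).

Definition closed_walks n e : nat := sumn [seq walks n q q e | q <- states].

Lemma sum_full_seq (T : finType) (s : seq T) (F : T -> nat) :
  uniq s -> (forall x, x \in s) -> \sum_x F x = sumn [seq F x | x <- s].
Proof.
move=> uniq_s full_s; rewrite sumnE big_map; apply: perm_big.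
by apply: uniq_perm => [||x]; rewrite ?index_enum_uniq ?mem_index_enum ?full_s.
Qed.

Lemma mem_columns z : z \in columns.
Proof. by case: z => [[] []]. Qed.

Lemma mem_states p : p \in states.
Proof. by case: p => [[[] []] [[] []]]. Qed.

Lemma big_tupleS (T : finType) n (F : seq T -> nat) :
  \sum_(u : n.+1.-tuple T) F u = \sum_z \sum_(u : n.-tuple T) F (z :: u).
Proof.
rewrite pair_big /=.
rewrite (reindex (fun zu : T * n.-tuple T => [tuple of zu.1 :: zu.2])) //.
exists (fun u : n.+1.-tuple T => (thead u, [tuple of behead u])) => [[z u] _|u _] /=.
  by rewrite theadE; congr (_, _); apply: val_inj.
by rewrite [RHS]tuple_eta; apply: val_inj.
Qed.

Lemma walks0 q p e : walks 0 q p e = delta q p e.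
Proof.
rewrite /walks (big_pred1 [tuple]) => [|u]; last by apply/esym/eqP/tuple0.
by rewrite /= /delta andbC -surjective_pairing.
Qed.

Lemma walksS n q p e : walks n.+1 q p e = transfer (walks n q) p e.
Proof.
rewrite /walks /transfer
  (big_tupleS n (fun u => walk p.1 p.2 u e && (endpoint p.1 p.2 u == q))).
rewrite (sum_full_seq _ _ mem_columns) //; congr sumn; apply: eq_map => z /=.
by case: ifP => [/andP[-> ->]//|cz]; apply: big1 => u _; rewrite andbA cz.
Qed.

(** The operator never looks at a weight above [e], so truncating tables at weight 4 loses
    nothing. *)
Lemma eq_transfer v w p e :
  (forall p e', e' <= e -> v p e' = w p e') -> transfer v p e = transfer w p e.
Proof.
move=> vw; congr sumn; apply: eq_map => z.
by case: ifP => // _; apply: vw; apply: leq_subr.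
Qed.

Lemma transfer_lin a v b w p e :
  transfer (fun p e => a * v p e + b * w p e) p e =
  a * transfer v p e + b * transfer w p e.
Proof.
rewrite /transfer /=.
by do !case: ifP => _; lia.
Qed.

(** * Evaluation on tables *)

Definition tabulate (v : state -> nat -> nat) : seq (seq nat) :=
  [seq [seq v p e | e <- iota 0 5] | p <- states].

Definition lookup (t : seq (seq nat)) (p : state) (e : nat) : nat :=
  nth 0 (nth [::] t (index p states)) e.

(** Tabulating after every step stores the values, so that evaluation does not enumerate walks. *)
Definition table n q : seq (seq nat) :=
  iter n (fun t => tabulate (transfer (lookup t))) (tabulate (delta q)).

Lemma lookup_tabulate v p e : e <= 4 -> lookup (tabulate v) p e = v p e.
Proof.
move=> e4; rewrite /lookup (nth_map p) ?index_mem ?mem_states //.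
by rewrite nth_index ?mem_states // (nth_map 0) ?size_iota // nth_iota.
Qed.

Lemma walks_table n q p e : e <= 4 -> walks n q p e = lookup (table n q) p e.
Proof.
elim: n p e => [|n IHn] p e e4; first by rewrite walks0 /= lookup_tabulate.
rewrite walksS /= lookup_tabulate //; apply: eq_transfer => p' e' e'e.
by apply: IHn; apply: leq_trans e4.
Qed.

Lemma closed_walks_table n e : e <= 4 ->
  closed_walks n e = sumn [seq lookup (table n q) q e | q <- states].
Proof.
by move=> e4; congr sumn; apply: eq_map => q; apply: walks_table.
Qed.

(** * Linear recurrence and closed formulas *)

Definition add_tables a (s : seq (seq nat)) b t : seq (seq nat) :=
  tabulate (fun p e => a * lookup s p e + b * lookup t p e).

Lemma add_tables_lookup a b c d s t s' t' p e : e <= 4 ->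
  add_tables a s b t = add_tables c s' d t' ->
  a * lookup s p e + b * lookup t p e = c * lookup s' p e + d * lookup t' p e.
Proof.
by move=> e4 /(congr1 (fun t => lookup t p e)); rewrite !lookup_tabulate.
Qed.

(** This is [T^9 (T^4 - 1)^3 = 0] on each [delta q] up to weight 4, expanded with the negative terms
    moved across to stay in [nat]. The cube leaves room for quadratic growth on each residue class
    modulo 4. *)
Lemma table_recurrence :
  all (fun q => add_tables 1 (table 21 q) 3 (table 13 q)
                == add_tables 3 (table 17 q) 1 (table 9 q)) states.
Proof. by vm_compute. Qed.

Lemma walks_recurrence n q p e : 9 <= n -> e <= 4 ->
  walks (n + 12) q p e + 3 * walks (n + 4) q p e =
  3 * walks (n + 8) q p e + walks n q p e.
Proof.
move=> n9 e4; rewrite -[walks (n + 12) _ _ _]mul1n -[walks n _ _ _]mul1n.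
have {n9} [m ->] : exists m, n = m + 9 by exists (n - 9); lia.
rewrite -!(addnA m); elim: m p e e4 => [|m IHm] p e e4.
  rewrite !(walks_table _ _ _ e4); apply: (add_tables_lookup _ e4).
  exact: (eqP (allP table_recurrence q (mem_states q))).
rewrite ![m.+1 + _]addSn !walksS -!transfer_lin; apply: eq_transfer => p' e' e'e.
by apply: IHm; apply: leq_trans e4.
Qed.

Lemma closed_walks_recurrence n e : 9 <= n -> e <= 4 ->
  closed_walks (n + 12) e + 3 * closed_walks (n + 4) e =
  3 * closed_walks (n + 8) e + closed_walks n e.
Proof.
move=> n9 e4; rewrite /closed_walks; elim: states => //= q s IHs.
by have := walks_recurrence q q n9 e4; lia.
Qed.

(* Meaningful only for [e] equal to 0, 2 or 4. *)
Definition closed_walks_formula n e : nat :=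
  match e with
  | 0 => if n %% 4 == 0 then 4 else 0
  | 2 => if n == 3 then 9 else if odd n then 2 * n else 0
  | _ => if n == 6 then 51 else if odd n then 0 else n * (n + 2)
  end.

(** The recurrence has order 12 and starts at 9, so the values at 9 to 20 seed it; those at 3 to 8
    include the exceptions 3 and 6. *)
Lemma closed_walks_small :
  all (fun n => all (fun e =>
    sumn [seq lookup (table n q) q e | q <- states] == closed_walks_formula n e)
    [:: 0; 2; 4]) (iota 3 18).
Proof. by vm_compute. Qed.

Lemma closed_walksE n e : 3 <= n -> e \in [:: 0; 2; 4] ->
  closed_walks n e = closed_walks_formula n e.
Proof.
move=> n3 eE.
have e4 : e <= 4 by move: eE; rewrite !inE => /or3P[] /eqP ->.
elim/ltn_ind: n n3 => n IHn n3.
have [n_lt | n_ge] := ltnP n 21.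
  rewrite (closed_walks_table _ e4); apply/eqP.
  by apply: (allP (allP closed_walks_small n _)) => //; rewrite mem_iota; lia.
have [m [nE m9]] : exists m, n = m + 12 /\ 9 <= m by exists (n - 12); lia.
have := closed_walks_recurrence m9 e4.
rewrite -nE (IHn m) ?(IHn (m + 4)) ?(IHn (m + 8)); try lia.
(* From 9 on, the formula is a polynomial of degree at most 2 on each residue class modulo 4, so its
   third difference with step 4 vanishes. *)
rewrite nE {IHn n_ge n3 nE}; move: eE; rewrite !inE => /or3P[] /eqP -> /=.
- by do !case: eqP => ?; lia.
- by rewrite !ifN_eq; try lia; rewrite !oddD /= !addbF; case: ifP; lia.
- by rewrite !ifN_eq; try lia; rewrite !oddD /= !addbF; case: ifP; lia.
Qed.

(** * Dominating sets as closed walks *)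

Definition walk_nth x y u i : column := nth (false, false) (x :: y :: u) i.

Lemma walkE x y u e :
  walk x y u e =
  \big[andb/true]_(i < size u)
     covered (walk_nth x y u i) (walk_nth x y u i.+1) (walk_nth x y u i.+2)
  && (\sum_(i < size u)
     excess (walk_nth x y u i) (walk_nth x y u i.+1) (walk_nth x y u i.+2) == e).
Proof.
elim: u x y e => [|z u IHu] x y e /=; first by rewrite !big_ord0 eq_sym.
rewrite !big_ord_recl /= IHu -andbA; congr (_ && _).
rewrite andbCA; congr (_ && _).
rewrite [walk_nth _ _ _ 0]/= [walk_nth _ _ _ 1]/= [walk_nth _ _ _ 2]/=.
have -> : forall a b c : nat, (a + b == c) = (a <= c) && (b == c - a) by lia.
by [].
Qed.

Lemma endpointE x y u :
  endpoint x y u = (walk_nth x y u (size u), walk_nth x y u (size u).+1).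
Proof. by elim: u x y => //= z u IHu x y; rewrite IHu. Qed.

Section Prism.

Variable n : nat.
Hypothesis n_gt2 : 2 < n.
Implicit Types (u : n.-tuple column) (i : 'I_n) (S : {set bool * 'I_n}).

Definition covered_at u i :=
  covered (tnth u (ord_pred i)) (tnth u i) (tnth u (ordS i)).
Definition excess_at u i :=
  excess (tnth u (ord_pred i)) (tnth u i) (tnth u (ordS i)).

(** Starting from the last two columns of [u] closes the walk up: its entry [i] is column [i - 2]
    modulo [n]. *)
Lemma walk_nth_cyclic u i (x := nth (false, false) u n.-2)
    (y := nth (false, false) u n.-1) :
  [/\ walk_nth x y u i = tnth u (ord_pred (ord_pred i)),
      walk_nth x y u i.+1 = tnth u (ord_pred i) &
      walk_nth x y u i.+2 = tnth u i].
Proof.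
have predE (j : 'I_n) : ord_pred j = (if j == 0 :> nat then n.-1 else j.-1) :> nat.
  rewrite /=; have := ltn_ord j; case: (nat_of_ord j) => [|k] lt_k /=.
    by rewrite modn_small; lia.
  by rewrite modnDr modn_small; lia.
rewrite !(tnth_nth (false, false)) !predE /walk_nth; split => //.
- by case: (nat_of_ord i) => [|[|k]] //=; case: eqP => //=; lia.
- by case: (nat_of_ord i) => [|k].
Qed.

Lemma closed_walksE_cyclic e :
  closed_walks n e =
  \sum_(u : n.-tuple column)
    ([forall i, covered_at u i] && (\sum_i excess_at u i == e)).
Proof.
rewrite /closed_walks -(sum_full_seq _ _ mem_states) // /walks exchange_big /=.
apply: eq_bigr => u _.
pose x := nth (false, false) u n.-2; pose y := nth (false, false) u n.-1.
(* As [u] has at least two columns, its endpoint does not depend on the start, so only one state [q]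
   can contribute. *)
have endE q : endpoint q.1 q.2 u = (x, y).
  rewrite endpointE size_tuple /walk_nth /x /y.
  by move: (tval u) n_gt2 => s; case: (n) => [|[|m]].
rewrite (bigD1 (x, y)) //= big1 ?addn0; last first.
  by move=> q /negPf qxy; rewrite endE [_ == q]eq_sym qxy andbF.
rewrite (endE (x, y)) eqxx andbT walkE size_tuple; congr nat_of_bool; congr andb.
  transitivity (\big[andb/true]_i covered_at u i); last first.
    by rewrite big_andE; apply: eq_forallb.
  (* Window [i] of the walk is centred at column [i - 1]. *)
  rewrite [RHS](reindex_inj (@ord_pred_inj n)) /=.
  apply: eq_bigr => i _; have [-> -> ->] := walk_nth_cyclic u i.
  by rewrite /covered_at ord_predK.
congr (_ == e); rewrite [RHS](reindex_inj (@ord_pred_inj n)) /=.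
apply: eq_bigr => i _; have [-> -> ->] := walk_nth_cyclic u i.
by rewrite /excess_at ord_predK.
Qed.

Definition vertices u : {set bool * 'I_n} :=
  [set v | if v.1 then (tnth u v.2).1 else (tnth u v.2).2].

Lemma vertices_bij : bijective vertices.
Proof.
exists (fun S => [tuple ((true, i) \in S, (false, i) \in S) | i < n]) => [u|S].
  by apply: eq_from_tnth => i; rewrite tnth_mktuple !inE /=; case: (tnth u i).
by apply/setP => -[[] i]; rewrite !inE tnth_mktuple.
Qed.

Lemma dominating_vertices u :
  dominating (@prism n) (vertices u) = [forall i, covered_at u i].
Proof.
have domE b i : ((b, i) \in vertices u) ||
    [exists v in vertices u, prism (b, i) v] =
    (0 < (if b then domt else domb)
           (tnth u (ord_pred i)) (tnth u i) (tnth u (ordS i))).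
  (* These four vertices form the closed neighbourhood of [(b, i)]. *)
  transitivity [|| (b, ord_pred i) \in vertices u, (b, i) \in vertices u,
                   (b, ordS i) \in vertices u | (~~ b, i) \in vertices u].
    apply/orP/or4P => [[Vbi|/existsP[[c j]]]|].
    - by constructor 2.
    - rewrite /prism /= => /andP[Vcj].
      case/orP => [/andP[/eqP-> /orP[]/eqP jE]|/andP[bc /eqP->]].
      + by rewrite -jE; constructor 3.
      + by rewrite -jE; constructor 1.
      + by constructor 4; case: b c bc Vcj => [] [].
    have adj c j : (c, j) \in vertices u -> prism (b, i) (c, j) ->
        [exists v in vertices u, prism (b, i) v].
      by move=> Vcj e_cj; apply/existsP; exists (c, j); rewrite Vcj.
    case=> V_; [right | by left | right | right]; apply: adj V_ _.
    + by rewrite /prism /= !eqxx orbT.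
    + by rewrite /prism /= !eqxx.
    + by rewrite /prism /= eqxx andbT; case: b.
  by rewrite !inE; case: b => /=; rewrite /domt /domb; lia.
apply/forallP/forallP => [dom i | cov [b i]].
  by rewrite /covered_at /covered -(domE true) -(domE false) !dom.
by rewrite domE; have /andP[] := cov i; case: b.
Qed.

Lemma card_vertices u : #|vertices u| = \sum_i ((tnth u i).1 + (tnth u i).2).
Proof.
rewrite -sum1_card big_mkcond /=.
transitivity (\sum_b \sum_i (if (b, i) \in vertices u then 1 else 0)).
  by rewrite pair_big; apply: eq_bigr => -[].
rewrite big_bool /= -big_split; apply: eq_bigr => i _ /=.
by rewrite !inE /=; case: (tnth u i) => [[] []].
Qed.

Lemma sum_excess u : [forall i, covered_at u i] ->
  \sum_i excess_at u i + 2 * n = 4 * #|vertices u|.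
Proof.
move=> /forallP cov.
have -> : 2 * n = \sum_(i < n) 2 by rewrite sum_nat_const card_ord mulnC.
rewrite -big_split /= card_vertices.
pose c i : nat := (tnth u i).1 + (tnth u i).2.
have sum_pred : \sum_i c (ord_pred i) = \sum_i c i.
  by rewrite [RHS](reindex_inj (@ord_pred_inj n)).
have sum_succ : \sum_i c (ordS i) = \sum_i c i.
  by rewrite [RHS](reindex_inj (@ordS_inj n)).
(* Coverage makes both predecessors exact, so the local excess plus 2 counts the dominations of
   column [i]; summed cyclically, each chosen vertex counts four times. *)
transitivity (\sum_i (c (ord_pred i) + (c i + c i) + c (ordS i))).
  apply: eq_bigr => i _; have := cov i.
  rewrite /covered_at /excess_at /covered /excess /c /domt /domb => /andP[]; lia.
rewrite -[RHS]/(4 * \sum_i c i); clearbody c.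
by rewrite !big_split /= sum_pred sum_succ; move: (\sum_i c i) => s; lia.
Qed.

Lemma card_dominating k :
  #|[set S | dominating (@prism n) S & #|S| == k]| =
  if 2 * n <= 4 * k then closed_walks n (4 * k - 2 * n) else 0.
Proof.
rewrite -sum1_card big_mkcond /= (reindex vertices) /=; last first.
  exact: onW_bij vertices_bij.
transitivity (\sum_(u : n.-tuple column) ([forall i, covered_at u i] &&
    (\sum_i excess_at u i + 2 * n == 4 * k))).
  apply: eq_bigr => u _; rewrite inE dominating_vertices.
  case: (boolP [forall i, covered_at u i]) => //= cov.
  by rewrite (sum_excess cov) eqn_pmul2l //; case: eqP.
case: ifP => [le_nk|lt_kn].
  rewrite closed_walksE_cyclic; apply: eq_bigr => u _; congr (nat_of_bool (_ && _)).
  by lia.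
by apply: big1 => u _; rewrite andbC; case: eqP => //; lia.
Qed.

End Prism.

(** * From closed walks to the dominion *)

Lemma dominionE (T : finType) (e : rel T) k m :
  (forall j, j < k -> #|[set S | dominating e S & #|S| == j]| = 0) ->
  #|[set S | dominating e S & #|S| == k]| = m -> 0 < m -> dominion e = m.
Proof.
move=> no_lt card_k m_gt0; rewrite /dominion.
suff -> : domination_number e = k by [].
rewrite /domination_number; case: arg_minnP => [|S domS minS].
  by apply/forallP => v; rewrite inE.
move: m_gt0; rewrite -card_k card_gt0 => /set0Pn[S'].
rewrite inE => /andP[domS' /eqP cardS']; apply/eqP.
rewrite eqn_leq -{1}cardS' minS //= leqNgt; apply/negP => /no_lt /eqP.
by rewrite cards_eq0 => /eqP/setP/(_ S); rewrite !inE domS eqxx.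
Qed.

(** Lowering the size by one lowers the weight by 4, so a dominating set smaller than [k] could only
    have weight 0, with [4 * k - 2 * n = 4]; [no_perfect] excludes this. *)
Lemma dominion_prism n k m : 2 < n -> 2 * n <= 4 * k -> 4 * k - 2 * n <= 4 ->
  (4 * k - 2 * n = 4 -> closed_walks n 0 = 0) ->
  closed_walks n (4 * k - 2 * n) = m -> 0 < m -> dominion (@prism n) = m.
Proof.
move=> n_gt2 le_nk le_kn no_perfect cwE; apply: (@dominionE _ _ k) => [j lt_jk|].
  rewrite card_dominating //; case: ifP => // le_nj.
  have -> : 4 * j - 2 * n = 0 by lia.
  by apply: no_perfect; lia.
by rewrite card_dominating // le_nk.
Qed.

Theorem theorem3p1 (n : nat) (hn : 3 <= n) :
  [/\ n = 3 -> dominion (@prism n) = 9,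
      n %% 4 = 0 -> dominion (@prism n) = 4,
      n %% 4 = 1 \/ n %% 4 = 3 -> n <> 3 -> dominion (@prism n) = 2 * n,
      n = 6 -> dominion (@prism n) = 51 &
      n %% 4 = 2 -> 10 <= n -> dominion (@prism n) = n * (n + 2)].
Proof.
split.
- by move=> n3; subst n; apply: (@dominion_prism _ 2) => //; rewrite closed_walksE.
- move=> n0; apply: (@dominion_prism _ (n %/ 2)) => //; try lia.
  have -> : 4 * (n %/ 2) - 2 * n = 0 by lia.
  by rewrite closed_walksE //= n0.
(* For odd [n] the weight is 2 modulo 4, so the least candidate is 2. *)
- move=> n13 n_neq3; apply: (@dominion_prism _ (n %/ 2).+1) => //; try lia.
  have -> : 4 * (n %/ 2).+1 - 2 * n = 2 by lia.
  by rewrite closed_walksE //=; case: eqP => // _; case: ifP => //; lia.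
- by move=> n6; subst n; apply: (@dominion_prism _ 4) => //; rewrite closed_walksE.
(* Size [n / 2] would need weight 0, which has no closed walk here; the next size has weight 4. *)
- move=> n2 n_ge10; apply: (@dominion_prism _ (n %/ 2).+1) => //; try lia.
    by rewrite closed_walksE //= n2.
  have -> : 4 * (n %/ 2).+1 - 2 * n = 4 by lia.
  by rewrite closed_walksE //= ifN_eq; try lia; case: ifP; lia.
Qed.
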